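(* For every positive integer $q$, \[ L_s(2,q) = 2^{q(q-1)} N_s(q) - 1 \quad\text{and}\quad L_e(2,q) = 2^{q(q-1)} N_e(q). \]
   Context: All graphs are simple undirected labeled graphs on the vertex set $\{1,\dots,n\}$. For such a graph with adjacency matrix $W$ and degree matrix $D$, its Laplacian is $L = D - W$; if the graph has at least one edge, its normalized Laplacian matrix is $\frac{1}{\mathrm{Tr}(L)}L$, which is a density matrix (Hermitian, positive semidefinite, trace $1$). An $n\times n$ density matrix $\rho$ with $n=pq$ is separable in $\mathbb{C}^p\otimes\mathbb{C}^q$ if $\rho=\sum_i c_i\,\rho_i\otimes\eta_i$ (finite sum) where the $\rho_i$ are $p\times p$ density matrices, the $\eta_i$ are $q\times q$ density matrices, $c_i\ge 0$ and $\sum_i c_i=1$; otherwise it is entangled. $L_s(p,q)$ denotes the number of labeled graphs on $n=pq$ vertices with at least one edge whose normalized Laplacian matrix is separable in $\mathbb{C}^p\otimes\mathbb{C}^q$, and $L_e(p,q)$ the number of those whose normalized Laplacian is entangled; thus $L_s(p,q)+L_e(p,q)=L(pq):=2^{pq(pq-1)/2}-1$. A square matrix is line sum symmetric if for each $i$ its $i$-th row sum equals its $i$-th column sum. $N_s(n)$ denotes the number of $n\times n$ matrices with entries in $\{0,1\}$ that are line sum symmetric, and $N_e(n)=2^{n^2}-N_s(n)$ the number of $n\times n$ $0$-$1$ matrices that are not line sum symmetric. *)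

(* Defs.v *)
From HB Require Import structures.
From mathcomp Require Import all_boot all_order all_algebra.
Set Implicit Arguments. Unset Strict Implicit. Unset Printing Implicit Defensive.
Import Order.TTheory GRing.Theory Num.Theory.
From Stdlib Require Import ClassicalEpsilon.

Definition asbool (P : Prop) : bool :=
  if excluded_middle_informative P then true else false.

Local Open Scope ring_scope.

(* A labeled simple graph on vertices 'I_n is encoded by its boolean
   adjacency matrix: symmetric with false diagonal. *)
Definition simple_graph n (W : 'M[bool]_n) : bool :=
  [forall i, ~~ W i i] && [forall i, [forall j, W i j == W j i]].

Definition has_edge n (W : 'M[bool]_n) : bool := [exists i, [exists j, W i j]].

Section Quantum.
Variable C : numClosedFieldType.

Definition adjC n (W : 'M[bool]_n) : 'M[C]_n := \matrix_(i, j) (W i j)%:R.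

Definition degC n (W : 'M[bool]_n) : 'M[C]_n :=
  \matrix_(i, j) (if i == j then (\sum_k (W i k)%:R) else 0).

Definition laplacian n (W : 'M[bool]_n) : 'M[C]_n := degC W - adjC W.

Definition normLap n (W : 'M[bool]_n) : 'M[C]_n :=
  (\tr (laplacian W))^-1 *: laplacian W.

Definition adjoint m n (A : 'M[C]_(m, n)) : 'M[C]_(n, m) :=
  \matrix_(i, j) (A j i)^*.

Definition hermitian n (A : 'M[C]_n) : bool := adjoint A == A.

Definition psd n (A : 'M[C]_n) : Prop :=
  forall v : 'cV[C]_n, 0 <= (adjoint v *m A *m v) 0 0.

Definition density n (A : 'M[C]_n) : Prop :=
  hermitian A /\ psd A /\ \tr A = 1.

(* Kronecker product A (x) B, with the standard index convention
   (i, j) |-> i * q + j (0-based). *)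
Definition kron p q (A : 'M[C]_p) (B : 'M[C]_q) : 'M[C]_(p * q) :=
  \matrix_(k, l) \sum_(i < p) \sum_(j < q) \sum_(i' < p) \sum_(j' < q)
     (if ((k : nat) == i * q + j)%N && ((l : nat) == i' * q + j')%N
      then A i i' * B j j' else 0).

Definition separable p q (rho : 'M[C]_(p * q)) : Prop :=
  exists s : seq (C * 'M[C]_p * 'M[C]_q),
    [/\ forall t, t \in s -> 0 <= t.1.1 /\ density t.1.2 /\ density t.2,
        \sum_(t <- s) t.1.1 = 1
      & rho = \sum_(t <- s) t.1.1 *: kron t.1.2 t.2].

End Quantum.

Definition Ls (C : numClosedFieldType) p q : nat :=
  #|[set W : 'M[bool]_(p * q) | simple_graph W && has_edge W &
       asbool (separable (normLap C W))]|.

Definition Le (C : numClosedFieldType) p q : nat :=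
  #|[set W : 'M[bool]_(p * q) | simple_graph W && has_edge W &
       ~~ asbool (separable (normLap C W))]|.

Definition line_sum_symmetric n (A : 'M[bool]_n) : bool :=
  [forall i, (\sum_j (A i j : nat) == \sum_j (A j i : nat))%N].

Definition Ns n : nat := #|[set A : 'M[bool]_n | line_sum_symmetric A]|.
Definition Ne n : nat := (2 ^ (n * n) - Ns n)%N.

(* Main.v *)
Require Import Defs.
From HB Require Import structures.
From mathcomp Require Import all_boot all_order all_algebra.
From mathcomp Require Import ring.
From mathcomp Require Import perm fingroup separable cyclic cyclotomic.
Set Implicit Arguments. Unset Strict Implicit. Unset Printing Implicit Defensive.
Import Order.TTheory GRing.Theory Num.Theory.
Local Open Scope ring_scope.

(* A product state whose entries sum to 0 has a factor annihilated by the
   all-ones vector, and a hermitian 2 x 2 factor so annihilated is symmetric.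
   Since the entries of a Laplacian sum to 0, this forces the off-diagonal
   q x q block A of a separable graph to be line sum symmetric.

   Conversely the edges inside a copy of 'I_q contribute multiples of
   e_a e_a^* (x) (e_i - e_j)(e_i - e_j)^*.  If A is line sum symmetric, some
   permutation sends each edge i -> j of the digraph A to an edge leaving j;
   following it yields closed walks x_t, and averaging the product states of
   (-z, 1) and sum_t z^t e_(x_t) over the roots of unity z yields the part of
   the Laplacian coming from A.

   The two diagonal blocks of a simple graph are free, which gives the factor
   2^(q(q-1)). *)

(** X^n - 1 splits and, in characteristic 0, is separable; its n distinct roots must include a
    primitive one. *)
Lemma prim_root_exists (C : numClosedFieldType) n :
  (0 < n)%N -> exists z : C, n.-primitive_root z.
Proof.
move=> n_gt0; pose p : {poly C} := 'X^n - 1.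
have [r Dp] := closed_field_poly_normal p.
rewrite lead_coefDl ?size_polyXn ?size_polyN ?size_poly1 // in Dp.
rewrite lead_coefXn scale1r in Dp.
have rn1: all n.-unity_root r by apply/allP=> z; rewrite -root_prod_XsubC -Dp.
have sz_r: (n < (size r).+1)%N.
  by rewrite -(size_prod_XsubC r id) -Dp size_XnsubC.
have [|z] := hasP (has_prim_root n_gt0 rn1 _ sz_r); last by exists z.
by rewrite -separable_prod_XsubC -Dp separable_Xn_sub_1 // pnatr_eq0 -lt0n.
Qed.

(** * Index pairs and Kronecker products *)

Section Indexing.
Variables p q : nat.

Lemma pair_ord_proof (i : 'I_p) (j : 'I_q) : (i * q + j < p * q)%N.
Proof.
apply: leq_trans (_ : i.+1 * q <= _)%N; last by rewrite leq_mul2r ltn_ord orbT.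
by rewrite mulSn addnC ltn_add2r.
Qed.

Definition pair_ord (u : 'I_p * 'I_q) : 'I_(p * q) :=
  Ordinal (pair_ord_proof u.1 u.2).

Lemma pair_ord_inj : injective pair_ord.
Proof.
move=> [i j] [i' j'] /(congr1 val) /= e.
have q0 : (0 < q)%N by apply: leq_ltn_trans (ltn_ord j).
have ei := congr1 (divn ^~ q) e; have ej := congr1 (modn ^~ q) e.
rewrite /= !divnMDl // !divn_small // !addn0 in ei.
rewrite /= !modnMDl !modn_small // in ej.
by congr pair; apply: val_inj.
Qed.

Lemma pair_ord_bij : bijective pair_ord.
Proof. by apply: inj_card_bij pair_ord_inj _; rewrite card_prod !card_ord. Qed.

Lemma pair_ordP (k : 'I_(p * q)) : exists u, k = pair_ord u.
Proof. by have [g _ gK] := pair_ord_bij; exists (g k); rewrite gK. Qed.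

Lemma sum_pair_ord (V : nmodType) (F : 'I_(p * q) -> V) :
  \sum_k F k = \sum_i \sum_j F (pair_ord (i, j)).
Proof.
rewrite (reindex pair_ord) /=; last exact/onW_bij/pair_ord_bij.
by rewrite pair_bigA; apply: eq_bigr => -[].
Qed.


Lemma pair_ord_mxP (T : Type) (A B : 'M[T]_(p * q)) :
  (forall u v, A (pair_ord u) (pair_ord v) = B (pair_ord u) (pair_ord v)) ->
  A = B.
Proof.
move=> AB; apply/matrixP=> k l.
by have [u ->] := pair_ordP k; have [v ->] := pair_ordP l.
Qed.

(** Injectivity of [pair_ord] leaves a single nonzero summand in the fourfold sum defining
    [kron]. *)
Lemma kronE (C : numClosedFieldType) (A : 'M[C]_p) (B : 'M[C]_q) u v :
  kron A B (pair_ord u) (pair_ord v) = A u.1 v.1 * B u.2 v.2.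
Proof.
have pE (w : 'I_p * 'I_q) (i : 'I_p) (j : 'I_q) :
    (w.1 * q + w.2 == i * q + j)%N = (w == (i, j)).
  exact: (inj_eq pair_ord_inj w (i, j)).
rewrite mxE pair_bigA /= (bigD1 u) //= [X in _ + X]big1 ?addr0 => [|u' u'Du].
  rewrite pair_bigA /= (bigD1 v) //= [X in _ + X]big1 ?addr0 => [|v' v'Dv].
    by rewrite !pE -!surjective_pairing !eqxx.
  by rewrite !pE -!surjective_pairing [v == _]eq_sym (negPf v'Dv) andbF.
apply: big1 => i _; apply: big1 => j _.
by rewrite pE -surjective_pairing eq_sym (negPf u'Du).
Qed.

End Indexing.

(** * Positive semidefinite matrices and rank one states *)

Section Cone.
Variable C : numClosedFieldType.

Lemma adjointM m n p (A : 'M[C]_(m, n)) (B : 'M[C]_(n, p)) :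
  adjoint (A *m B) = adjoint B *m adjoint A.
Proof.
apply/matrixP=> i j; rewrite !mxE rmorph_sum; apply: eq_bigr => k _.
by rewrite !mxE rmorphM mulrC.
Qed.

Lemma adjointBZ m n (A B : 'M[C]_(m, n)) (s : C) :
  adjoint (A - s *: B) = adjoint A - s^* *: adjoint B.
Proof. by apply/matrixP=> i j; rewrite !mxE rmorphB rmorphM. Qed.

Lemma qformE n (A : 'M[C]_n) (v : 'cV[C]_n) :
  (adjoint v *m A *m v) 0 0 = \sum_i \sum_j (v i 0)^* * A i j * v j 0.
Proof.
rewrite mxE exchange_big; apply: eq_bigr => j _.
by rewrite mxE mulr_suml; apply: eq_bigr => i _; rewrite mxE.
Qed.

Lemma psd_sum_ge0 n (A : 'M[C]_n) : psd A -> 0 <= \sum_i \sum_j A i j.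
Proof.
move/(_ (const_mx 1)); rewrite qformE.
by under eq_bigr do under eq_bigr do rewrite !mxE rmorph1 mulr1 mul1r.
Qed.

(* If A v = r <> 0, the form is negative at v - s r for small s > 0. *)
Lemma psd_isotropic n (A : 'M[C]_n) (v : 'cV[C]_n) :
  Defs.hermitian A -> psd A -> (adjoint v *m A *m v) 0 0 = 0 -> A *m v = 0.
Proof.
move=> /eqP hA pA qv; pose r := A *m v.
pose a := (adjoint r *m r) 0 0; pose b := (adjoint r *m A *m r) 0 0.
have aE : a = \sum_i r i 0 * (r i 0)^*.
  by rewrite /a mxE; apply: eq_bigr => i _; rewrite mxE mulrC.
have a_ge0 : 0 <= a by rewrite aE sumr_ge0 // => i _; apply: mul_conjC_ge0.
have b_ge0 : 0 <= b by apply: pA.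
have vA : adjoint v *m A = adjoint r by rewrite /r adjointM hA.
have b1 : 0 < b + 1 by rewrite ltr_wpDl.
have : a = 0.
  apply/eqP/negPn/negP=> a_neq0; have a_gt0 : 0 < a by rewrite lt_def a_neq0.
  (* For real s the form at v - s r equals -2sa + s^2 b. This choice gives s b < a, and the [+ 1]
     covers b = 0. *)
  pose s := a / (b + 1); have s_gt0 : 0 < s by rewrite divr_gt0.
  have sC : s^* = s by rewrite geC0_conj // ltW.
  have := pA (v - s *: r); rewrite adjointBZ sC.
  have -> : (adjoint v - s *: adjoint r) *m A *m (v - s *: r) =
      adjoint v *m A *m v - (s *+ 2) *: (adjoint r *m r)
      + s ^+ 2 *: (adjoint r *m A *m r).
    rewrite mulmxBl !mulmxBr !mulmxBl -!scalemxAr -!scalemxAl vA.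
    rewrite -[adjoint r *m A *m v]mulmxA -/r scalerA -expr2 mulr2n.
    rewrite scalerDl.
    by rewrite opprB opprD !addrA [in RHS]addrAC.
  have E (X Y Z : 'M[C]_1) c d :
      (X - c *: Y + d *: Z) 0 0 = X 0 0 - c * Y 0 0 + d * Z 0 0 by rewrite !mxE.
  rewrite E qv -/a -/b sub0r addrC subr_ge0 -mulr_natl -mulrA expr2 -mulrA.
  rewrite mulrCA ler_pM2l // /s mulrAC ler_pdivlMr // -mulrA mulrCA ler_pM2l //.
  rewrite lt_geF // mulr_natl mulr2n addrAC -addrA addrA -addrA ltrDl.
  by rewrite addr_gt0 ?ltr_wpDl ?ltr01.
rewrite aE => /psumr_eq0P r0; apply/colP=> i; rewrite [RHS]mxE -/r; apply/eqP.
by rewrite -mul_conjC_eq0 r0 // => k _; apply: mul_conjC_ge0.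
Qed.

Definition outer n (x : 'I_n -> C) : 'M[C]_n :=
  \matrix_(i, j) (x i * (x j)^*).

Lemma mxtrace_outer n (x : 'I_n -> C) : \tr (outer x) = \sum_i x i * (x i)^*.
Proof. by apply: eq_bigr => i _; rewrite mxE. Qed.

Lemma mxtrace_outer_ge0 n (x : 'I_n -> C) : 0 <= \tr (outer x).
Proof.
by rewrite mxtrace_outer sumr_ge0 // => i _; apply: mul_conjC_ge0.
Qed.

Lemma mxtrace_outer_eq0 n (x : 'I_n -> C) : \tr (outer x) = 0 -> outer x = 0.
Proof.
rewrite mxtrace_outer => /psumr_eq0P x0; apply/matrixP=> i j; rewrite !mxE.
suff -> : x i = 0 by rewrite mul0r.
by apply/eqP; rewrite -mul_conjC_eq0 x0 // => k _; apply: mul_conjC_ge0.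
Qed.

Lemma density_outer n (x : 'I_n -> C) :
  \tr (outer x) != 0 -> density ((\tr (outer x))^-1 *: outer x).
Proof.
move=> x0; have t0 := mxtrace_outer_ge0 x; split; last split.
- apply/eqP/matrixP=> i j; rewrite !mxE !rmorphM /= conjCK.
  by rewrite [(_^-1)^*]geC0_conj ?invr_ge0 // [_^* * _]mulrC.
- move=> v; rewrite qformE; set c := _^-1.
  (* The form at [v] is [c] times the squared modulus of the pairing of [v] with [x]. *)
  have -> : \sum_i \sum_j (v i 0)^* * (c *: outer x) i j * v j 0 =
      c * ((\sum_i (v i 0)^* * x i) * (\sum_i (v i 0)^* * x i)^*).
    rewrite rmorph_sum mulr_suml mulr_sumr; apply: eq_bigr => i _.
    rewrite !mulr_sumr; apply: eq_bigr => j _.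
    by rewrite !mxE rmorphM /= conjCK; ring.
  by rewrite mulr_ge0 ?invr_ge0 // mul_conjC_ge0.
- by rewrite mxtraceZ mulVf.
Qed.

(** * The cone of separable matrices *)

(** Separability without normalized weights, so that the pieces of a Laplacian can be built apart
    and added. *)
Definition sep_cone p q (rho : 'M[C]_(p * q)) : Prop :=
  exists s : seq (C * 'M[C]_p * 'M[C]_q),
    (forall t, t \in s -> 0 <= t.1.1 /\ density t.1.2 /\ density t.2) /\
    rho = \sum_(t <- s) t.1.1 *: kron t.1.2 t.2.

Section ConeOps.
Variables p q : nat.
Implicit Types rho : 'M[C]_(p * q).

Lemma sep_cone0 : sep_cone (0 : 'M[C]_(p * q)).
Proof. by exists [::]; rewrite big_nil. Qed.

Lemma sep_coneD rho1 rho2 :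
  sep_cone rho1 -> sep_cone rho2 -> sep_cone (rho1 + rho2).
Proof.
move=> [s1 [h1 ->]] [s2 [h2 ->]]; exists (s1 ++ s2); rewrite big_cat; split=> //.
by move=> t; rewrite mem_cat => /orP[/h1|/h2].
Qed.

Lemma sep_coneZ c rho : 0 <= c -> sep_cone rho -> sep_cone (c *: rho).
Proof.
move=> c0 [s [h ->]]; exists [seq (c * t.1.1, t.1.2, t.2) | t <- s]; split.
  by move=> _ /mapP[t /h[h1 h2] ->]; split; rewrite ?mulr_ge0.
by rewrite big_map scaler_sumr; apply: eq_bigr => t _; rewrite scalerA.
Qed.

Lemma sep_cone_sum (I : finType) (F : I -> 'M[C]_(p * q)) :
  (forall i, sep_cone (F i)) -> sep_cone (\sum_i F i).
Proof.
by move=> h; elim/big_ind: _ => //; [apply: sep_cone0 | apply: sep_coneD].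
Qed.

Lemma kronZ a b (A : 'M[C]_p) (B : 'M[C]_q) :
  kron (a *: A) (b *: B) = (a * b) *: kron A B.
Proof.
by apply: pair_ord_mxP => u v; rewrite [RHS]mxE !kronE !mxE mulrACA.
Qed.

(** A factor of trace 0 is the zero matrix; otherwise both factors are normalized and the weight is
    the product of their traces. *)
Lemma sep_cone_outer (x : 'I_p -> C) (y : 'I_q -> C) :
  sep_cone (kron (outer x) (outer y)).
Proof.
have [x0|x0] := eqVneq (\tr (outer x)) 0.
  rewrite (mxtrace_outer_eq0 x0) -[0](scale0r 0) -[outer y]scale1r kronZ.
  by rewrite mul0r scale0r; apply: sep_cone0.
have [y0|y0] := eqVneq (\tr (outer y)) 0.
  rewrite (mxtrace_outer_eq0 y0) -[0](scale0r 0) -[outer x]scale1r kronZ.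
  by rewrite mulr0 scale0r; apply: sep_cone0.
exists [:: (\tr (outer x) * \tr (outer y), (\tr (outer x))^-1 *: outer x,
            (\tr (outer y))^-1 *: outer y)]; split=> [t|].
  rewrite inE => /eqP-> /=; split; last by split; apply: density_outer.
  by rewrite mulr_ge0 ?mxtrace_outer_ge0.
rewrite big_seq1 /= kronZ scalerA mulrACA !divff // mulr1 scale1r //.
Qed.

Lemma mxtrace_kron (A : 'M[C]_p) (B : 'M[C]_q) :
  \tr (kron A B) = \tr A * \tr B.
Proof.
rewrite /mxtrace sum_pair_ord mulr_suml; apply: eq_bigr => i _.
by rewrite mulr_sumr; apply: eq_bigr => j _; rewrite kronE.
Qed.

(** Products of density matrices have trace 1, so the trace of [rho] is the sum of the weights. *)
Lemma separable_cone rho : \tr rho = 1 -> sep_cone rho -> Defs.separable rho.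
Proof.
move=> tr1 [s [h e]]; exists s; split=> //; rewrite -tr1 e raddf_sum /=.
apply: eq_big_seq => t /h[_ [[_ [_ t1]] [_ [_ t2]]]].
by rewrite mxtraceZ mxtrace_kron t1 t2 !mulr1.
Qed.

End ConeOps.

(** * Row sums forced by separability *)

(** The sum of the entries is the form at the all-ones vector, which is thus isotropic. *)
Lemma density_sum_eq0 n (A : 'M[C]_n) :
  density A -> \sum_i \sum_j A i j = 0 -> forall i, \sum_j A i j = 0.
Proof.
move=> [hA [pA _]] A0 i.
have /colP/(_ i) e : A *m const_mx 1 = 0 :> 'cV[C]_n.
  apply: psd_isotropic => //; rewrite qformE -[RHS]A0.
  by under eq_bigr do under eq_bigr do rewrite !mxE rmorph1 mulr1 mul1r.
transitivity ((A *m const_mx 1 : 'cV[C]_n) i 0); last by rewrite e mxE.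
by rewrite mxE; apply: eq_bigr => j _; rewrite mxE mulr1.
Qed.

(** The first row gives [A 0 1 = - A 0 0], which is real, and [A 1 0] is its conjugate. *)
Lemma hermitian2_row_sum0 (A : 'M[C]_2) :
  Defs.hermitian A -> (forall i, \sum_j A i j = 0) -> A 0 1 = A 1 0.
Proof.
move=> /eqP/matrixP hA A0; have h00 := hA 0 0; have h01 := hA 1 0.
rewrite !mxE in h00 h01; move: (A0 0).
rewrite big_ord_recl big_ord1 (_ : lift _ _ = 1) => [/eqP|]; last exact: val_inj.
rewrite addrC addr_eq0 => /eqP e; rewrite -h01 e rmorphN.
by congr (- _); rewrite -[LHS]h00.
Qed.

(** Each product term has a nonnegative entry sum, so all of these vanish. Then the weight is 0, or
    the first factor is symmetric and the two blocks of the term agree, or the second factor has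
    zero row sums and both sides are 0. *)
Lemma separable_block_row_sums q (rho : 'M[C]_(2 * q)) :
  Defs.separable rho -> \sum_k \sum_l rho k l = 0 -> forall j,
  \sum_j' rho (pair_ord (0, j)) (pair_ord (1, j')) =
  \sum_j' rho (pair_ord (1, j)) (pair_ord (0, j')).
Proof.
move=> [s [hs _ e]] sum0 j.
pose S n (A : 'M[C]_n) := \sum_i \sum_j A i j.
have rhoE u v : rho (pair_ord u) (pair_ord v) =
    \sum_(t <- s) t.1.1 * (t.1.2 u.1 v.1 * t.2 u.2 v.2).
  by rewrite e summxE; apply: eq_bigr => t _; rewrite mxE kronE.
have : \sum_(t <- s) t.1.1 * (S _ t.1.2 * S _ t.2) = 0.
  transitivity (\sum_k \sum_l rho k l); last by [].
  rewrite sum_pair_ord.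
  under [RHS]eq_bigr do under eq_bigr do rewrite sum_pair_ord.
  under [RHS]eq_bigr do under eq_bigr do under eq_bigr do under eq_bigr do
    rewrite rhoE.
  (* Four exchanges carry the sum over the decomposition outside the four index sums, where each
     term factors. *)
  under [RHS]eq_bigr do under eq_bigr do under eq_bigr do rewrite exchange_big.
  under [RHS]eq_bigr do under eq_bigr do rewrite exchange_big.
  under [RHS]eq_bigr do rewrite exchange_big.
  rewrite [RHS]exchange_big; apply: eq_bigr => t _ /=.
  have -> : S _ t.1.2 * S _ t.2 =
      \sum_a \sum_i \sum_b \sum_j t.1.2 a b * t.2 i j.
    rewrite /S mulr_suml; apply: eq_bigr => a _.
    rewrite mulr_sumr; apply: eq_bigr => i _.
    by rewrite mulr_suml; apply: eq_bigr => b _; rewrite mulr_sumr.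
  rewrite mulr_sumr; apply: eq_bigr => a _.
  rewrite mulr_sumr; apply: eq_bigr => i _.
  rewrite mulr_sumr; apply: eq_bigr => b _.
  by rewrite mulr_sumr; apply: eq_bigr.
move=> sum0'.
have term0 t : t \in s -> t.1.1 * (S _ t.1.2 * S _ t.2) = 0.
  move: sum0'; rewrite big_seq => /eqP; rewrite psumr_eq0.
    by move/allP=> h ts; apply/eqP; have := h t ts; rewrite ts.
  move=> t' /hs[t0 [[_ [p1 _]] [_ [p2 _]]]].
  by rewrite mulr_ge0 // mulr_ge0 //; apply: psd_sum_ge0.
under eq_bigr do rewrite rhoE; under [RHS]eq_bigr do rewrite rhoE.
rewrite exchange_big [RHS]exchange_big; apply: eq_big_seq => t ts /=.
rewrite -!mulr_sumr; have [_ [d1 d2]] := hs t ts.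
have /eqP := term0 t ts; rewrite !mulf_eq0 => /or3P[/eqP->|/eqP S0|/eqP S0].
- by rewrite !mul0r.
- by rewrite (hermitian2_row_sum0 d1.1 (density_sum_eq0 d1 S0)).
- by rewrite (density_sum_eq0 d2 S0) !mulr0.
Qed.

End Cone.

(** * Averages over roots of unity *)

Section RootSums.
Variables (C : numClosedFieldType) (n : nat) (w : C).
Hypothesis prim_w : n.-primitive_root w.

Lemma prim_root_mul_conj : w * w^* = 1.
Proof.
have n0 := prim_order_gt0 prim_w.
rewrite -normCK; suff -> : `|w| = 1 by rewrite expr1n.
apply/eqP; rewrite -(pexpr_eq1 n0) // -normrX (prim_expr_order prim_w).
by rewrite normr1.
Qed.

(** Conjugation inverts [w], so this is a geometric sum of ratio u = w^(s - t), where u^n = 1. *)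
Lemma sum_prim_root s t :
  \sum_(m < n) (w ^+ m) ^+ s * ((w ^+ m) ^+ t)^* =
  if s == t %[mod n] then n%:R else 0.
Proof.
pose u := w ^+ s * (w ^+ t)^*.
have -> : \sum_(m < n) (w ^+ m) ^+ s * ((w ^+ m) ^+ t)^* = \sum_(m < n) u ^+ m.
  apply: eq_bigr => m _.
  by rewrite -![(w ^+ m) ^+ _]exprM ![(m * _)%N]mulnC !exprM rmorphXn exprMn.
have w0 : w != 0.
  apply: contra_eq_neq prim_root_mul_conj => ->.
  by rewrite mul0r eq_sym oner_eq0.
have uE : u = w ^+ s / w ^+ t.
  congr (_ * _); rewrite rmorphXn -exprVn; congr (_ ^+ _).
  by apply: (mulfI w0); rewrite mulfV // prim_root_mul_conj.
have -> : (s == t %[mod n]) = (u == 1).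
  rewrite -(eq_prim_root_expr prim_w) uE -subr_eq0 -[RHS]subr_eq0.
  rewrite -[X in _ / _ - X](mulfV (expf_neq0 t w0)) -mulrBl mulf_eq0 invr_eq0.
  by rewrite expf_eq0 (negPf w0) andbF orbF.
have [->|u1] := eqVneq.
  by under eq_bigr do rewrite expr1n; rewrite sumr_const card_ord.
(* Multiplication by the nonzero u - 1 telescopes the sum to u^n - 1 = 0. *)
apply/eqP; rewrite -(mulrI_eq0 _ (mulfI (_ : u - 1 != 0))) ?subr_eq0 //.
rewrite -subrX1 subr_eq0 uE exprMn exprVn -!exprM ![(_ * n)%N]mulnC !exprM.
by rewrite (prim_expr_order prim_w) !expr1n invr1 mulr1.
Qed.

(** Coordinate [j] of the vector sum_t z^t e_(x_t), at the root of unity z = w^m. *)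
Definition walk_vec q (x : nat -> 'I_q) (m : nat) (j : 'I_q) : C :=
  \sum_(t < n) (w ^+ m) ^+ t * (x t == j)%:R.

(* Averaging over the n-th roots of unity keeps exactly the pairs of times
   that differ by s along the closed walk x. *)
Lemma sum_walk_vec q (x : nat -> 'I_q) (s : nat) (j j' : 'I_q) :
  (forall t, x (t %% n)%N = x t) ->
  \sum_(m < n) (w ^+ m) ^+ s * (walk_vec x m j * (walk_vec x m j')^*) =
  n%:R * \sum_(t < n) (x t == j)%:R * (x (t + s)%N == j')%:R.
Proof.
move=> hx; have n0 := prim_order_gt0 prim_w.
transitivity (\sum_(m < n) \sum_(t < n) \sum_(t' < n)
    (x t == j)%:R * (x t' == j')%:R *
    ((w ^+ m) ^+ (t + s) * ((w ^+ m) ^+ t')^*)).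
  apply: eq_bigr => m _; rewrite /walk_vec rmorph_sum mulr_suml mulr_sumr.
  apply: eq_bigr => t _; rewrite !mulr_sumr; apply: eq_bigr => t' _.
  by rewrite rmorphM rmorph_nat exprD; ring.
rewrite exchange_big mulr_sumr; apply: eq_bigr => t _.
rewrite exchange_big /=; under eq_bigr do rewrite -mulr_sumr sum_prim_root.
(* The only surviving time [t'] is the residue of t + s; periodicity of [x] then removes the
   reduction. *)
pose t0 := Ordinal (ltn_pmod (t + s) n0).
rewrite (bigD1 t0) //= modn_mod eqxx hx big1 ?addr0 1?mulrC // => t' t'D.
rewrite ifN ?mulr0 //; apply: contraNneq t'D => e.
by apply/eqP/val_inj; rewrite /= e modn_small.
Qed.
End RootSums.

(** Equal fiber sizes make the two tuples of values equal as multisets. *)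
Lemma perm_of_fibers (T : eqType) n (f g : 'I_n -> T) :
  (forall v, \sum_k (f k == v) = \sum_k (g k == v))%N ->
  exists s : 'S_n, forall k, f k = g (s k).
Proof.
move=> fg; have : perm_eq (mktuple f) (mktuple g).
  apply/allP=> v _; apply/eqP; have := fg v.
  rewrite /= !count_map -!sum1_count /= -!enumT !big_enum_cond /= => e.
  by rewrite big_mkcond [RHS]big_mkcond; exact: e.
case/tuple_permP=> s e; exists s => k.
have /(congr1 (fun u => tnth u k)) : mktuple f = [tuple tnth (mktuple g) (s i) | i < n].
  exact: val_inj.
by rewrite !tnth_mktuple.
Qed.

(** * Edges between the two copies of ['I_q] *)

Section Cross.
Variable q : nat.
Variable A : 'M[bool]_q.

Definition edges : {set 'I_q * 'I_q} := [set e | A e.1 e.2].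
Definition edge_tail (k : 'I_#|edges|) : 'I_q := (enum_val k).1.
Definition edge_head (k : 'I_#|edges|) : 'I_q := (enum_val k).2.

Lemma sum_edges (V : nmodType) (F : 'I_q -> 'I_q -> V) :
  \sum_k F (edge_tail k) (edge_head k) = \sum_i \sum_j F i j *+ A i j.
Proof.
rewrite -(big_enum_val (fun e => F e.1 e.2)) pair_bigA big_mkcond /=.
by apply: eq_bigr => e _; rewrite inE; case: (A _ _).
Qed.

(** Heads at [v] are counted by a column sum of [A], tails at [v] by the matching row sum. *)
Lemma successor_perm : line_sum_symmetric A ->
  exists s : 'S_#|edges|, forall k, edge_head k = edge_tail (s k).
Proof.
move=> /forallP hA; apply: perm_of_fibers => v.
transitivity (\sum_j A j v)%N.
  rewrite (sum_edges (fun _ j => (j == v) : nat)); apply: eq_bigr => i _.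
  rewrite (bigD1 v) //= eqxx big1 => [|j /negPf ->]; last by rewrite mul0rn.
  by rewrite addr0; case: (A i v).
rewrite -(eqP (hA v)) (sum_edges (fun j _ => (j == v) : nat)) exchange_big /=.
apply: eq_bigr => i _.
rewrite (bigD1 v) //= eqxx big1 => [|j /negPf ->]; last by rewrite mul0rn.
by rewrite addr0; case: (A v i).
Qed.

Variable C : numClosedFieldType.

(** The sign produces the negative off-diagonal entries of a Laplacian. *)
Definition phase_vec (z : C) (a : 'I_2) : C := if a == 0 then - z else 1.

(** In a diagonal block the phases cancel and the average keeps lag 0, which counts the edges
    leaving [j]. Off the diagonal a factor -z or its conjugate remains and keeps lag 1, which
    recovers the edges themselves. *)
Lemma cross_cone : line_sum_symmetric A ->
  exists2 M : 'M[C]_(2 * q), sep_cone M & forall a b j j',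
    M (pair_ord (a, j)) (pair_ord (b, j')) =
    if a == b then (\sum_k A j k)%N%:R *+ (j == j')
    else if a == 0 then - (A j j')%:R else - (A j' j)%:R.
Proof.
(* The order of the successor permutation is a common period for the walks from all edges. *)
case/successor_perm=> s hs; pose n := #[s]%g.
have [w prim_w] := prim_root_exists C (order_gt0 s : (0 < n)%N).
have nn0 : n%:R != 0 :> C by apply: prim_root_natf_neq0 prim_w.
pose x k t := edge_tail ((s ^+ t)%g k).
have hx k t : x k (t %% n)%N = x k t by rewrite /x expg_mod_order.
(* [r] is the lag. One factor [n] comes from the root sum, the other from the [n] times: reindexing
   the edges by [s ^+ t] makes every time contribute like time 0. *)
have key r j j' :
    \sum_k \sum_(m < n) (w ^+ m) ^+ r *
      (walk_vec n w (x k) m j * (walk_vec n w (x k) m j')^*) =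
    n%:R ^+ 2 * \sum_k (edge_tail k == j)%:R * (edge_tail ((s ^+ r)%g k) == j')%:R.
  under eq_bigr do rewrite (sum_walk_vec prim_w) //.
  rewrite -mulr_sumr exchange_big /= expr2 -mulrA; congr (_ * _).
  rewrite -[n in RHS]card_ord -[in RHS]sumr_const mulr_suml.
  apply: eq_bigr => t _; rewrite mul1r [RHS](reindex_inj (@perm_inj _ (s ^+ t)%g)).
  by apply: eq_bigr => k _; rewrite /x expgD permM.
have key0 j j' :
    \sum_k \sum_(m < n) walk_vec n w (x k) m j * (walk_vec n w (x k) m j')^* =
    n%:R ^+ 2 * ((\sum_k A j k)%N%:R *+ (j == j')).
  transitivity (n%:R ^+ 2 * \sum_k (edge_tail k == j)%:R *
      (edge_tail ((s ^+ 0)%g k) == j')%:R : C).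
    rewrite -key; apply: eq_bigr => k _; apply: eq_bigr => m _.
    by rewrite expr0 mul1r.
  congr (_ * _); under [LHS]eq_bigr do rewrite expg0 perm1.
  rewrite (sum_edges (fun i _ => (i == j)%:R * (i == j')%:R)).
  rewrite (bigD1 j) //= [X in _ + X]big1 => [|i /negPf iD].
    rewrite eqxx mul1r addr0 natr_sum; case: (j == j') => /=.
      exact: eq_bigr.
    by rewrite mulr0n big1 // => l _; rewrite mul0rn.
  by apply: big1 => l _; rewrite iD mul0r mul0rn.
have key1 j j' :
    \sum_k \sum_(m < n) w ^+ m *
      (walk_vec n w (x k) m j * (walk_vec n w (x k) m j')^*) =
    n%:R ^+ 2 * (A j j')%:R.
  transitivity (n%:R ^+ 2 * \sum_k (edge_tail k == j)%:R *
      (edge_tail ((s ^+ 1)%g k) == j')%:R : C).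
    by rewrite -key; apply: eq_bigr.
  congr (_ * _); under eq_bigr do rewrite expg1 -hs.
  rewrite (sum_edges (fun i l => (i == j)%:R * (l == j')%:R)).
  rewrite (bigD1 j) //= [X in _ + X]big1 => [|i /negPf iD].
    rewrite addr0 (bigD1 j') //= big1 => [|l /negPf lD].
      by rewrite !eqxx mulr1 addr0.
    by rewrite lD mulr0 mul0rn.
  by apply: big1 => l _; rewrite iD mul0r mul0rn.
exists ((n%:R ^- 2) *: \sum_k \sum_(m < n)
    kron (outer (phase_vec (w ^+ m))) (outer (walk_vec n w (x k) m))).
  apply: sep_coneZ; first by rewrite invr_ge0 exprn_ge0.
  by do 2!apply: sep_cone_sum => ?; apply: sep_cone_outer.
move=> a b j j'; rewrite mxE.
have -> : (\sum_k \sum_(m < n) kron (outer (phase_vec (w ^+ m)))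
      (outer (walk_vec n w (x k) m))) (pair_ord (a, j)) (pair_ord (b, j')) =
    \sum_k \sum_(m < n) phase_vec (w ^+ m) a * (phase_vec (w ^+ m) b)^* *
      (walk_vec n w (x k) m j * (walk_vec n w (x k) m j')^*).
  rewrite summxE; apply: eq_bigr => k _; rewrite summxE.
  by apply: eq_bigr => m _; rewrite kronE !mxE.
apply: (canLR (mulKf (expf_neq0 2 nn0))).
have zz m : w ^+ m * (w ^+ m)^* = 1.
  by rewrite rmorphXn -exprMn (prim_root_mul_conj prim_w) expr1n.
have [<-|abD] := eqVneq a b.
  rewrite -key0; apply: eq_bigr => k _; apply: eq_bigr => m _.
  rewrite /phase_vec; case: ifP => _; last by rewrite rmorph1 !mul1r.
  by rewrite rmorphN mulrNN zz mul1r.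
have [a0|a0] := eqVneq a 0.
  have b0 : b != 0 by rewrite eq_sym -a0.
  rewrite mulrN -key1 -sumrN; apply: eq_bigr => k _.
  rewrite -sumrN; apply: eq_bigr => m _.
  by rewrite /phase_vec a0 eqxx (negPf b0) rmorph1 mulr1 mulNr.
have b0 : b = 0.
  by apply/eqP; move: abD a0; case: (a) (b) => [[|[|?]] ?] [[|[|?]] ?].
(* The remaining block is the conjugate of [key1] with [j] and [j'] swapped; the integers on the
   right are real. *)
have -> : (A j' j)%:R = ((A j' j)%:R : C)^* by rewrite rmorph_nat.
have -> : n%:R = (n%:R : C)^* by rewrite rmorph_nat.
rewrite mulrN -rmorphXn -rmorphM -key1 rmorph_sum -sumrN; apply: eq_bigr => k _.
rewrite rmorph_sum -sumrN; apply: eq_bigr => m _.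
rewrite /phase_vec b0 eqxx (negPf a0) rmorphN !rmorphM /= conjCK; ring.
Qed.
End Cross.

(** * Edges inside one copy of ['I_q] *)

Lemma inner_cone (C : numClosedFieldType) q (a : 'I_2) (B : rel 'I_q) :
  symmetric B -> exists2 M : 'M[C]_(2 * q), sep_cone M & forall b c j j',
    M (pair_ord (b, j)) (pair_ord (c, j')) =
    if (b == a) && (c == a)
    then (\sum_k B j k)%N%:R *+ (j == j') - (B j j')%:R else 0.
Proof.
move=> symB.
(* Ordered pairs count each edge twice, hence [2^-1]; a loop contributes the zero vector. *)
exists (2^-1 *: \sum_i \sum_l (B i l)%:R *:
    kron (outer (fun b => (b == a)%:R)) (outer (fun j => (i == j)%:R - (l == j)%:R))).
  apply: sep_coneZ; first by rewrite invr_ge0 ler0n.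
  do 2!apply: sep_cone_sum => ?; apply: sep_coneZ; first exact: ler0n.
  exact: sep_cone_outer.
move=> b c j j'; rewrite mxE.
have -> : (\sum_i \sum_l (B i l)%:R *: kron (outer (fun b => (b == a)%:R))
      (outer (fun j => (i == j)%:R - (l == j)%:R)))
      (pair_ord (b, j)) (pair_ord (c, j')) =
    \sum_i \sum_l (B i l)%:R * ((b == a)%:R * ((c == a)%:R)^* *
      (((i == j)%:R - (l == j)%:R) * ((i == j')%:R - (l == j')%:R)^*)) :> C.
  rewrite summxE; apply: eq_bigr => i _; rewrite summxE.
  by apply: eq_bigr => l _; rewrite mxE kronE !mxE.
have [_|_] := eqVneq b a; last first.
  rewrite big1 ?mulr0 // => i _; rewrite big1 // => l _.
  by rewrite mul0r mul0r mulr0.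
have [_|_] := eqVneq c a; last first.
  rewrite big1 ?mulr0 // => i _; rewrite big1 // => l _.
  by rewrite rmorph0 mulr0 mul0r mulr0.
rewrite /= rmorph1.
have S (F : 'I_q -> C) v : \sum_i (i == v)%:R * F i = F v.
  rewrite (bigD1 v) //= eqxx mul1r big1 ?addr0 // => i /negPf ->.
  by rewrite mul0r.
have T v : \sum_i (B v i)%:R = (\sum_k B v k)%N%:R :> C by rewrite natr_sum.
(* Expanding the rank one matrix gives two diagonal terms, each a degree, and two mixed terms, each
   an entry of [B]; symmetry of [B] makes each pair agree. *)
transitivity (2^-1 * (\sum_i (i == j)%:R * ((i == j')%:R * \sum_l (B i l)%:R)
   - \sum_i (i == j)%:R * (\sum_l (l == j')%:R * (B i l)%:R)
   - \sum_i (i == j')%:R * (\sum_l (l == j)%:R * (B i l)%:R)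
   + \sum_l (l == j)%:R * ((l == j')%:R * \sum_i (B i l)%:R)) : C).
  congr (_ * _); rewrite [X in _ + X](_ : _ =
      \sum_i \sum_l (l == j)%:R * ((l == j')%:R * (B i l)%:R)).
    rewrite -!sumrB -big_split; apply: eq_bigr => i _ /=.
    rewrite !mulr_sumr -!sumrB -big_split; apply: eq_bigr => l _ /=.
    by rewrite rmorphB !rmorph_nat; ring.
  rewrite exchange_big; apply: eq_bigr => l _.
  by rewrite !mulr_sumr; apply: eq_bigr => i _.
rewrite !S T.
under [X in _ + _ * X]eq_bigr do rewrite symB.
rewrite T [B j' j]symB.
have h2 : (2 : C) != 0 by rewrite pnatr_eq0.
apply: (canLR (mulKf h2)).
case: (j == j'); rewrite ?mul1r ?mul0r ?mulr1n ?mulr0n; ring.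
Qed.

Definition cross_block q (W : 'M[bool]_(2 * q)) : 'M[bool]_q :=
  \matrix_(i, j) W (pair_ord (0, i)) (pair_ord (1, j)).

Lemma ord2_eq1 (a : 'I_2) : a != 0 -> a = 1.
Proof. by case: a => [[|[|//]] ?] // _; apply: val_inj. Qed.

(** * Entries and trace of the Laplacian *)

Section Laplacian.
Variables (C : numClosedFieldType) (n : nat) (W : 'M[bool]_n).

Lemma laplacianE k l :
  laplacian C W k l = (\sum_m W k m)%N%:R *+ (k == l) - (W k l)%:R.
Proof. by rewrite !mxE natr_sum; case: (k == l). Qed.

Lemma laplacian_sum : \sum_k \sum_l laplacian C W k l = 0.
Proof.
apply: big1 => k _; under eq_bigr do rewrite laplacianE.
rewrite sumrB (bigD1 k) //= eqxx [X in _ + X - _]big1 => [|l].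
  by rewrite addr0 natr_sum subrr.
by rewrite eq_sym => /negPf ->.
Qed.

Hypotheses (simpleW : simple_graph W) (edgeW : has_edge W).

Lemma mxtrace_laplacian_gt0 : 0 < \tr (laplacian C W).
Proof.
have /andP[/forallP W0 _] := simpleW.
have -> : \tr (laplacian C W) = (\sum_k \sum_l W k l)%N%:R.
  rewrite natr_sum; apply: eq_bigr => k _.
  by rewrite laplacianE eqxx (negPf (W0 k)) subr0.
have /existsP[k /existsP[l Wkl]] := edgeW.
by rewrite ltr0n (bigD1 k) //= (bigD1 l) //= Wkl.
Qed.

End Laplacian.

(** * The separability criterion *)

Section Criterion.
Variables (C : numClosedFieldType) (q : nat) (W : 'M[bool]_(2 * q)).
Hypotheses (simpleW : simple_graph W) (edgeW : has_edge W).

Let symW k l : W k l = W l k.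
Proof. by have /andP[_ /forallP/(_ k)/forallP/(_ l)/eqP] := simpleW. Qed.

Lemma separable_line_sum_symmetric :
  Defs.separable (normLap C W) -> line_sum_symmetric (cross_block W).
Proof.
have trW := mxtrace_laplacian_gt0 C simpleW edgeW.
have c0 : (\tr (laplacian C W))^-1 != 0 by rewrite invr_neq0 // gt_eqF.
move=> /separable_block_row_sums rowW; apply/forallP=> j; apply/eqP.
have {}rowW : \sum_j' (cross_block W j j')%:R = \sum_j' (cross_block W j' j)%:R :> C.
  have := rowW _ j.
  have -> : \sum_k \sum_l normLap C W k l = 0.
    under eq_bigr do under eq_bigr do rewrite mxE.
    under eq_bigr do rewrite -mulr_sumr.
    by rewrite -mulr_sumr laplacian_sum mulr0.
  move/(_ erefl).
  (* Vertices in different copies are distinct, so the degree terms vanish and only adjacency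
     entries remain. *)
  under eq_bigr do rewrite mxE laplacianE (inj_eq (@pair_ord_inj _ _)) mulr0n sub0r.
  under [RHS]eq_bigr do
    rewrite mxE laplacianE (inj_eq (@pair_ord_inj _ _)) mulr0n sub0r.
  rewrite -!mulr_sumr => /(mulfI c0); rewrite !sumrN => /oppr_inj e.
  transitivity (\sum_i (W (pair_ord (0, j)) (pair_ord (1, i)))%:R : C).
    by apply: eq_bigr => i _; rewrite mxE.
  by rewrite e; apply: eq_bigr => i _; rewrite mxE symW.
by apply/eqP; rewrite -(eqr_nat C) !natr_sum rowW.
Qed.

(** The Laplacian is the sum of the cross part and of one inner part for each copy, all in the
    cone. *)
Lemma line_sum_symmetric_separable :
  line_sum_symmetric (cross_block W) -> Defs.separable (normLap C W).
Proof.
move=> lssW; have trW := mxtrace_laplacian_gt0 C simpleW edgeW.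
apply: separable_cone; first by rewrite mxtraceZ mulVf // gt_eqF.
apply: sep_coneZ; first by rewrite invr_ge0 ltW.
have [M Mcone ME] := cross_cone C lssW.
have inner a := @inner_cone C q a
  (fun i j => W (pair_ord (a, i)) (pair_ord (a, j))) (fun i j => symW _ _).
have [M0 M0cone M0E] := inner 0; have [M1 M1cone M1E] := inner 1.
suff -> : laplacian C W = M + M0 + M1 by do 2!apply: sep_coneD => //.
apply: pair_ord_mxP => -[a j] [b j']; rewrite laplacianE 2!mxE ME M0E M1E.
rewrite (inj_eq (@pair_ord_inj _ _)) xpair_eqE sum_pair_ord big_ord_recl big_ord1.
rewrite (_ : lift _ _ = 1); last exact: val_inj.
have rowA i : (\sum_k cross_block W i k =
    \sum_k W (pair_ord (0%R, i)) (pair_ord (1%R, k)))%N.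
  by apply: eq_bigr => k _; rewrite mxE.
(* The degrees in the second copy involve column sums, while [cross_cone] supplies row sums; line
   sum symmetry reconciles them. *)
have colA i : (\sum_k cross_block W i k =
    \sum_k W (pair_ord (1%R, i)) (pair_ord (0%R, k)))%N.
  rewrite (eqP (forallP lssW i)).
  by apply: eq_bigr => k _; rewrite mxE symW.
have [->|/ord2_eq1 ->] := eqVneq a 0; have [->|/ord2_eq1 ->] := eqVneq b 0;
  rewrite /= ?eqxx /= ?mxE ?mulr0n ?sub0r ?addr0 //.
- by rewrite rowA addrA natrD mulrnDl [X in X - _ = _]addrC.
- by rewrite symW.
- by rewrite colA addrA natrD mulrnDl.
Qed.

End Criterion.

(** * Counting graphs by their off-diagonal block *)

Section Counting.
Variable q : nat.

Definition off_diagonal : {set 'I_q * 'I_q} := [set e | e.1 != e.2].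

Lemma card_off_diagonal : #|off_diagonal| = (q * (q - 1))%N.
Proof.
rewrite -sum1dep_card -(pair_big_dep predT (fun i j => i != j) (fun _ _ => 1%N)) /=.
transitivity (\sum_(i < q) (q - 1))%N; last by rewrite sum_nat_const card_ord.
apply: eq_bigr => i _; rewrite sum1dep_card subn1.
have := cardC1 i; rewrite card_ord => <-.
by apply: eq_card => j; rewrite !inE eq_sym.
Qed.

(* Ordered pairs i < j record the edges inside the first copy of 'I_q, and
   ordered pairs i > j those inside the second one. *)
Definition split_graph (W : 'M[bool]_(2 * q)) :
    {set 'I_q * 'I_q} * 'M[bool]_q :=
  ([set e : 'I_q * 'I_q |
      if (e.1 < e.2)%N then W (pair_ord (0, e.1)) (pair_ord (0, e.2))
      else (e.2 < e.1)%N && W (pair_ord (1, e.1)) (pair_ord (1, e.2))],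
   cross_block W).

Lemma simple_graphP n (W : 'M[bool]_n) :
  reflect ((forall i, W i i = false) /\ (forall i j, W i j = W j i))
          (simple_graph W).
Proof.
apply: (iffP andP) => -[W0 Ws]; split.
- by move=> i; have /forallP/(_ i)/negPf := W0.
- by move=> i j; have /forallP/(_ i)/forallP/(_ j)/eqP := Ws.
- by apply/forallP=> i; rewrite W0.
- by apply/forallP=> i; apply/forallP=> j; rewrite Ws.
Qed.

Lemma split_graph_inj : {in @simple_graph (2 * q) &, injective split_graph}.
Proof.
move=> W V /simple_graphP[W0 Ws] /simple_graphP[V0 Vs] [/setP eM /matrixP eA].
have e00 (i j : 'I_q) : (i < j)%N ->
    W (pair_ord (0, i)) (pair_ord (0, j)) = V (pair_ord (0, i)) (pair_ord (0, j)).
  by move=> ij; have := eM (i, j); rewrite !inE /= ij.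
have e11 (i j : 'I_q) : (j < i)%N ->
    W (pair_ord (1, i)) (pair_ord (1, j)) = V (pair_ord (1, i)) (pair_ord (1, j)).
  by move=> ij; have := eM (i, j); rewrite !inE /= ltnNge ltnW //= ij.
have e01 i j :
    W (pair_ord (0, i)) (pair_ord (1, j)) = V (pair_ord (0, i)) (pair_ord (1, j)).
  by have := eA i j; rewrite !mxE.
apply: pair_ord_mxP => -[a i] [b j].
have [->|/ord2_eq1 ->] := eqVneq a 0; have [->|/ord2_eq1 ->] := eqVneq b 0 => //.
- have [/e00//|/e00|/val_inj->] := ltngtP i j; last by rewrite W0 V0.
  by rewrite Ws Vs.
- by rewrite Ws Vs.
- have [/e11|/e11//|/val_inj->] := ltngtP i j; last by rewrite W0 V0.
  by rewrite Ws Vs.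
Qed.

Lemma split_graph_onto (M : {set 'I_q * 'I_q}) (A : 'M[bool]_q) :
  M \subset off_diagonal -> exists2 W, simple_graph W & split_graph W = (M, A).
Proof.
move=> /subsetP sM; have [g gK _] := pair_ord_bij 2 q.
(* [up] sorts a pair: increasing pairs of [M] code edges of the first copy, decreasing ones edges of
   the second. *)
pose up (i j : 'I_q) := if (i < j)%N then (i, j) else (j, i).
pose f (u v : 'I_2 * 'I_q) :=
  if u.1 == 0 then if v.1 == 0 then (u.2 != v.2) && (up u.2 v.2 \in M)
                   else A u.2 v.2
  else if v.1 == 0 then A v.2 u.2
       else (u.2 != v.2) && (((up u.2 v.2).2, (up u.2 v.2).1) \in M).
have upC i j : i != j -> up i j = up j i.
  by rewrite /up; case: ltngtP => // /val_inj ->; rewrite eqxx.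
have fC u v : f u v = f v u.
  rewrite /f; case: (u.1 == 0); case: (v.1 == 0) => //;
    rewrite [v.2 == _]eq_sym; case: eqVneq => //= uv; by rewrite upC.
have f0 u : f u u = false by rewrite /f !eqxx; case: (u.1 == 0).
exists (\matrix_(k, l) f (g k) (g l)).
  by apply/simple_graphP; split=> [i|i j]; rewrite !mxE // fC.
congr pair.
  apply/setP=> -[i j]; rewrite inE /= !mxE !gK /f /= /up.
  rewrite -(inj_eq val_inj); case: ltngtP => //= /val_inj ->.
  by apply/esym/negP=> /sM; rewrite inE eqxx.
by apply/matrixP=> i j; rewrite !mxE !gK.
Qed.

(** [split_graph] is a bijection onto pairs of a subset of [off_diagonal] and a matrix satisfying
    [P]. *)
Lemma card_simple_graph_cross (P : pred 'M[bool]_q) :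
  #|[set W | simple_graph W && P (cross_block W)]| =
  (2 ^ (q * (q - 1)) * #|[set A | P A]|)%N.
Proof.
rewrite -card_off_diagonal -card_powerset -cardsX.
rewrite -(card_in_imset (f := split_graph)); last first.
  by move=> W V; rewrite !inE => /andP[sW _] /andP[sV _]; apply: split_graph_inj.
apply: eq_card => -[M A]; rewrite in_setX powersetE; apply/imsetP/andP.
  case=> W; rewrite inE => /andP[/simple_graphP[_ _] PW] [-> ->]; split.
    apply/subsetP=> -[i j]; rewrite !inE /= -(inj_eq val_inj) neq_ltn.
    by case: ltngtP.
  by rewrite inE.
rewrite inE => -[/(split_graph_onto A)[W sW eW] PA].
by exists W; rewrite // inE sW; case: eW => _ ->.
Qed.
End Counting.

(** * From the criterion to the two counts *)

Lemma asboolP (P : Prop) : reflect P (asbool P).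
Proof.
by rewrite /asbool; case: ClassicalEpsilon.excluded_middle_informative => h; constructor.
Qed.

Lemma separable_normLapE (C : numClosedFieldType) q (W : 'M[bool]_(2 * q)) :
  simple_graph W -> has_edge W ->
  asbool (Defs.separable (normLap C W)) = line_sum_symmetric (cross_block W).
Proof.
move=> sW eW; apply/asboolP/idP.
  exact: separable_line_sum_symmetric.
exact: line_sum_symmetric_separable.
Qed.

Lemma line_sum_symmetric0 n : line_sum_symmetric (const_mx false : 'M[bool]_n).
Proof.
by apply/forallP=> i; apply/eqP; apply: eq_bigr => j _; rewrite !mxE.
Qed.

Lemma has_edgePn n (W : 'M[bool]_n) : ~~ has_edge W = (W == const_mx false).
Proof.
apply/idP/eqP => [|->]; last first.
  by apply/existsPn=> i; apply/existsPn=> j; rewrite mxE.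
move/existsPn=> W0; apply/matrixP=> i j; rewrite mxE.
by have /existsPn/(_ j)/negPf := W0 i.
Qed.

Theorem mainTheorem5 (C : numClosedFieldType) (q : nat) :
  (0 < q)%N ->
  Ls C 2 q = (2 ^ (q * (q - 1)) * Ns q - 1)%N /\
  Le C 2 q = (2 ^ (q * (q - 1)) * Ne q)%N.
Proof.
move=> _; pose E : 'M[bool]_(2 * q) := const_mx false.
have crossE : cross_block E = const_mx false.
  by apply/matrixP=> i j; rewrite !mxE.
split.
  rewrite -(card_simple_graph_cross (@line_sum_symmetric q)).
  (* The edgeless graph [E] has a line sum symmetric block but is excluded from [Ls]: this is the
     [- 1]. *)
  rewrite (cardsD1 E [set W | simple_graph W && _]) inE.
  have -> : simple_graph E by apply/simple_graphP; split=> *; rewrite !mxE.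
  rewrite crossE line_sum_symmetric0 add1n subn1 /=.
  apply: eq_card => W; rewrite !inE -has_edgePn negbK.
  case sW: (simple_graph W) => //=; last by rewrite andbF.
  by case eW: (has_edge W) => //=; apply: separable_normLapE.
have -> : Ne q = #|[set A | ~~ line_sum_symmetric (A : 'M[bool]_q)]|.
  rewrite /Ne -{1}[2%N]card_bool -card_mx -(cardsC [set A | line_sum_symmetric A]).
  by rewrite addKn; apply: eq_card => A; rewrite !inE.
rewrite -(card_simple_graph_cross (fun A => ~~ line_sum_symmetric A)).
apply: eq_card => W; rewrite !inE.
case sW: (simple_graph W) => //=; case eW: (has_edge W) => /=.
  by rewrite separable_normLapE.
(* The edgeless graph lies in neither set, so this count needs no correction. *)
move/negbT: eW; rewrite has_edgePn => /eqP ->.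
by rewrite crossE line_sum_symmetric0.
Qed.
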